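(* Let $\{(X_i,Y_i)\}_{i\ge 1}$ be a stationary ergodic sequence of random vectors with values in $\mathbb{R}^d\times\mathbb{R}$ such that $E|Y_1|<\infty$, and let $(X,Y)$ denote a random vector with the common distribution of the $(X_i,Y_i)$; let $\mu$ be the distribution of $X$. Let $L>0$ be arbitrary and let $N_n$ be a non-decreasing sequence of positive integers with $N_n\to\infty$. With $S$, $m_L$ and $\hat m_{n,L}$ as defined in the context, the following hold. (a) Almost surely, for all $x\in S$ simultaneously, $\hat m_{n,L}(x)\to m_L(x)$ as $n\to\infty$. (b) If $S$ is a bounded subset of $\mathbb{R}^d$, then almost surely $\sup_{x\in S}|\hat m_{n,L}(x)-m_L(x)|\to 0$. (c) If either (i) $|Y|\le D$ almost surely for some finite constant $D$ (which need not be known), or (ii) $\mu$ has bounded support, then almost surely $\int (\hat m_{n,L}(x)-m_L(x))^2\,\mu(dx)\to 0$.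
   Context: For $k\ge 1$, $\mathcal{P}_k=\{A_{k,i}: i=1,2,\dots\}$ is a partition of $\mathbb{R}^d$ into cubes of volume $(2^{-k-2})^d$ (side length $2^{-k-2}$), and the partitions are nested ($\mathcal{P}_{k+1}$ refines $\mathcal{P}_k$). For $x\in\mathbb{R}^d$, $A_k(x)$ denotes the cell of $\mathcal{P}_k$ containing $x$. The support is $S=\{x\in\mathbb{R}^d: \mu(A_k(x))>0 \text{ for all } k\ge 1\}$. For $x\in S$ put $M_k(x)=E(Y\mid X\in A_k(x))$, and for $k\ge 2$, $\Delta_{k,L}(x)=\mathrm{sign}(M_k(x)-M_{k-1}(x))\min(|M_k(x)-M_{k-1}(x)|,L2^{-k})$, and $m_L(x)=M_1(x)+\sum_{k=2}^\infty \Delta_{k,L}(x)$ (the series converges since $|\Delta_{k,L}|\le L2^{-k}$). Estimator: $\hat M_{k,n}(x)=\frac{\sum_{j=1}^n Y_j 1_{\{X_j\in A_k(x)\}}}{\sum_{j=1}^n 1_{\{X_j\in A_k(x)\}}}$, with $\hat M_{k,n}(x)=0$ if the denominator is $0$; for $k\ge 2$, $\hat\Delta_{k,n,L}(x)=\mathrm{sign}(\hat M_{k,n}(x)-\hat M_{k-1,n}(x))\min(|\hat M_{k,n}(x)-\hat M_{k-1,n}(x)|,L2^{-k})$; and $\hat m_{n,L}(x)=\hat M_{1,n}(x)+\sum_{k=2}^{N_n}\hat\Delta_{k,n,L}(x)$. *)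

(* Defs.v *)
From HB Require Import structures.
From mathcomp Require Import all_boot all_order all_algebra.
From mathcomp Require Import all_classical all_reals all_analysis.
Set Implicit Arguments. Unset Strict Implicit. Unset Printing Implicit Defensive.
Import Order.TTheory GRing.Theory Num.Theory.
Import numFieldNormedType.Exports.
Local Open Scope classical_set_scope.
Local Open Scope ring_scope.

Section Defs.
Variables (R : realType) (d : nat).

Definition Rd := 'I_d -> R.

Definition borelRd : set (set Rd) :=
  <<s [set C | exists (j : 'I_d) (B : set R), measurable B /\
                  C = [set y : Rd | B (y j)]] >>.

(* C is a cube of side h: sandwiched between the open and the closed cube
   with some lower corner a (boundary faces may or may not belong to C) *)
Definition cube (h : R) (C : set Rd) : Prop :=
  exists a : Rd,
    [set y : Rd | forall j, a j < y j < a j + h] `<=` C /\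
    C `<=` [set y : Rd | forall j, a j <= y j <= a j + h].

(* A k x = A_k(x), the cell of P_k containing x (only k >= 1 is used):
   for k >= 1, the P_k form nested partitions of R^d into (Borel) cubes of
   side 2^{-k-2}. *)
Definition nested_cube_partitions (A : nat -> Rd -> set Rd) : Prop :=
  [/\ (forall k x, (1 <= k)%N -> A k x x),
      (forall k x y, (1 <= k)%N -> A k x y -> A k y = A k x),
      (forall k x, (1 <= k)%N -> cube (2 ^- k.+2) (A k x)),
      (forall k x, (1 <= k)%N -> borelRd (A k x)) &
      (forall k x, (1 <= k)%N -> A k.+1 x `<=` A k x)].

Definition clip (L : R) (k : nat) (t : R) : R :=
  Num.sg t * Num.min `|t| (L * 2 ^- k).

Definition pathT := nat -> (Rd * R)%type.

Definition path_sigma : set (set pathT) :=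
  <<s [set C | exists (i : nat) (j : 'I_d) (B : set R), measurable B /\
                  C = [set z : pathT | B ((z i).1 j)]]
      `|` [set C | exists (i : nat) (B : set R), measurable B /\
                  C = [set z : pathT | B (z i).2]] >>.

Definition shift (z : pathT) : pathT := fun i => z i.+1.

Section Process.
Context {dO : measure_display} {Omega : measurableType dO}.
Variables (P : probability Omega R) (X : nat -> Omega -> Rd) (Y : nat -> Omega -> R).

Definition path (w : Omega) : pathT := fun i => (X i w, Y i w).

Definition stationary : Prop :=
  forall C, path_sigma C ->
    P (path @^-1` C) = P (path @^-1` (shift @^-1` C)).

Definition ergodic : Prop :=
  forall C, path_sigma C -> shift @^-1` C = C ->
    P (path @^-1` C) = 0%E \/ P (path @^-1` C) = 1%E.

Variables (A : nat -> Rd -> set Rd) (L : R) (N : nat -> nat).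

Definition Mk (k : nat) (x : Rd) : R :=
  fine (\int[P]_(w in X 0 @^-1` A k x) (Y 0 w)%:E) / fine (P (X 0 @^-1` A k x)).

Definition mL (x : Rd) : R :=
  Mk 1 x + limn (fun n => \sum_(2 <= k < n) clip L k (Mk k x - Mk k.-1 x)).

Definition supp : set Rd :=
  [set x | forall k, (1 <= k)%N -> (0 < P (X 0 @^-1` A k x))%E].

(* empirical estimator from the sample (X_j(w), Y_j(w)), j = 1..n
   (indexed here by j = 0..n-1) *)
Definition Mhat (k n : nat) (w : Omega) (x : Rd) : R :=
  let cnt := \sum_(j < n) \1_(A k x) (X j w) in
  if cnt == 0 then 0
  else (\sum_(j < n) Y j w * \1_(A k x) (X j w)) / cnt.

Definition mhat (n : nat) (w : Omega) (x : Rd) : R :=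
  Mhat 1 n w x +
  \sum_(2 <= k < (N n).+1) clip L k (Mhat k n w x - Mhat k.-1 n w x).

End Process.
End Defs.

(* Main.v *)
From Pilot Require Import Defs.
From HB Require Import structures.
From mathcomp Require Import all_boot all_order all_algebra.
From mathcomp Require Import all_classical all_reals all_analysis.
From mathcomp Require Import measurable_realfun lra zify.
Set Implicit Arguments. Unset Strict Implicit. Unset Printing Implicit Defensive.
Import Order.TTheory GRing.Theory Num.Theory.
Import numFieldNormedType.Exports.
Local Open Scope classical_set_scope.
Local Open Scope ring_scope.

(** By Birkhoff's ergodic theorem, applied to the shift on path space, almost
surely the empirical frequency and the empirical sum of the [Y_j] converge in
each of the countably many cells, so that [Mhat k n] tends to [Mk k] on every
cell of positive mass.  The corrections of level [k] are bounded by [L * 2 ^- k]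
uniformly in [n] and [x], and [clip] is 1-Lipschitz; dominated convergence for
series (Tannery) then gives pointwise convergence on the support, and uniform
convergence when only finitely many cells of each level meet the support.  The
support has full measure, and the error is eventually bounded in both cases of
(c), so that the integrated statement follows by dominated convergence. *)

(** * Birkhoff's ergodic theorem *)

Section Birkhoff.
Context {dT : measure_display} {T : measurableType dT} {R : realType}.
Variables (Q : probability T R) (S : T -> T).
Hypothesis mS : measurable_fun setT S.
Hypothesis preserveS : forall C, measurable C -> Q (S @^-1` C) = Q C.

Lemma integrable_preserving (f : T -> R) :
  Q.-integrable setT (EFin \o f) -> Q.-integrable setT (EFin \o (f \o S)).
Proof.
move=> /integrableP[mf fi]; apply/integrableP; split.
  by move/measurable_EFinP in mf; apply/measurable_EFinP; exact: (measurableT_comp mf mS).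
rewrite -(@ge0_integral_pushforward _ _ _ _ _ _ mS Q setT (fun x => `|(f x)%:E|)%E)//.
  rewrite (eq_measure_integral Q)// => A mA _.
  exact: preserveS.
exact: measurableT_comp.
Qed.

Lemma integral_preserving (f : T -> R) :
  Q.-integrable setT (EFin \o f) ->
  (\int[Q]_x (f (S x))%:E = \int[Q]_x (f x)%:E)%E.
Proof.
move=> fi; have /integrableP[mf _] := fi.
rewrite -[LHS](@integral_pushforward _ _ _ _ _ S mS Q setT (EFin \o f))//.
  by apply: eq_measure_integral => A mA _; exact: preserveS.
exact: integrable_preserving.
Qed.

(* [run_max f n] is the maximum of the first [n.+1] nonempty Birkhoff sums. *)
Fixpoint run_max (f : T -> R) (n : nat) (x : T) : R :=
  if n is m.+1 then f x + Num.max 0 (run_max f m (S x)) else f x.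

Lemma run_max_integrable f n :
  Q.-integrable setT (EFin \o f) -> Q.-integrable setT (EFin \o run_max f n).
Proof.
move=> fi; elim: n => [//|n IH].
have -> : EFin \o run_max f n.+1 =
   ((EFin \o f) \+ (EFin \o (fun x => Num.max 0%R (run_max f n (S x)))))%E.
  by [].
apply: integrableD => //.
have iS := integrable_preserving IH.
have mi : measurable_fun setT (run_max f n \o S).
  by apply/measurable_EFinP; exact: measurable_int iS.
apply: le_integrable iS => //.
  by apply/measurable_EFinP; exact: measurable_maxr.
by move=> x _ /=; rewrite lee_fin; case: (lerP 0 (run_max f n (S x))); rewrite ?normr0.
Qed.

Lemma run_max_ndS f n x : run_max f n x <= run_max f n.+1 x.
Proof.
elim: n x => [|n IH] x /=; first by rewrite lerDl le_max lexx.
by rewrite lerD2l ge_max !le_max lexx/= -/(run_max f n.+1 (S x)) IH orbT.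
Qed.

Lemma run_max_nd f x m n : (m <= n)%N -> run_max f m x <= run_max f n x.
Proof.
move=> /subnKC <-; elim: (n - m)%N => [|k IH]; first by rewrite addn0.
by rewrite addnS (le_trans IH)// run_max_ndS.
Qed.

Lemma run_max_ge_sum f n x : \sum_(j < n.+1) f (iter j S x) <= run_max f n x.
Proof.
elim: n x => [|n IH] x; first by rewrite big_ord1.
rewrite big_ord_recl/= lerD2l le_max; apply/orP; right.
apply: le_trans (IH _); apply: ler_sum => j _.
by rewrite /bump/= -iterSr.
Qed.

Definition unbounded_run f :=
  [set x | forall M : nat, exists n, M%:R < run_max f n x].

(** [run_max f n.+1 x] is [f x] plus the positive part of [run_max f n (S x)], so raising the
    threshold by [|f x|] carries unboundedness from either point to the other. *)
Lemma unbounded_run_invariant f : S @^-1` unbounded_run f = unbounded_run f.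
Proof.
apply/seteqP; split=> x /= Cx M.
  have [n Hn] := Cx (Num.truncn (M%:R + `|f x|)).+1.
  exists n.+1 => /=.
  have := truncnS_gt (M%:R + `|f x|); have := ler_norm (- f x); rewrite normrN => h1 h2.
  have : run_max f n (S x) <= Num.max 0 (run_max f n (S x)) by rewrite le_max lexx orbT.
  lra.
have [n Hn] := Cx (Num.truncn (M%:R + `|f x|)).+1.
have := truncnS_gt (M%:R + `|f x|); have := ler_norm (f x) => h1 h2.
(* A nonnegative threshold rules out the branch where the maximum is 0. *)
have M0 : (0 : R) <= M%:R by [].
have {}Hn := le_trans (ltW Hn) (run_max_ndS f n x).
exists n; move: Hn => /=.
by case: (lerP 0 (run_max f n (S x))) => h; lra.
Qed.

Lemma measurable_unbounded_run f :
  Q.-integrable setT (EFin \o f) -> measurable (unbounded_run f).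
Proof.
move=> fi.
have -> : unbounded_run f = \bigcap_M \bigcup_n [set x | M%:R < run_max f n x].
  apply/seteqP; split=> [x Cx M _|x Cx M]; first by have [n] := Cx M; exists n.
  by have [n] := Cx M I; exists n.
apply: bigcapT_measurable => M; apply: bigcupT_measurable => n.
have mr : measurable_fun setT (run_max f n).
  by apply/measurable_EFinP; exact: measurable_int (run_max_integrable _ fi).
rewrite -[X in measurable X]setTI.
have := mr measurableT `]M%:R, +oo[%classic (measurable_itv _).
by congr (measurable (_ `&` _)); apply/seteqP; split=> x /=; rewrite in_itv/= andbT.
Qed.

Hypothesis ergodicS : forall C, measurable C -> S @^-1` C = C -> Q C = 0%E \/ Q C = 1%E.

(* If [run_max f] were unbounded, hence a.s. unbounded by ergodicity, then
   [run_max f n.+1 - run_max f n \o S] would tend to [f] a.s., while its integral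
   is that of [run_max f n.+1 - run_max f n], which is nonnegative. *)
Lemma negative_mean_bounded_run (f : T -> R) :
  Q.-integrable setT (EFin \o f) -> (\int[Q]_x (f x)%:E < 0)%E ->
  {ae Q, forall x, exists M : nat, forall n, run_max f n x <= M%:R}.
Proof.
move=> fi fneg.
have mC := measurable_unbounded_run fi.
have [C0|C1] := ergodicS mC (unbounded_run_invariant f).
  exists (unbounded_run f); split => // x /= nb M.
  apply: contrapT => H; apply: nb; exists M => n.
  by rewrite leNgt; apply/negP => H'; apply: H; exists n.
exfalso.
pose g n x := (run_max f n.+1 x - run_max f n (S x))%:E.
have iF n := run_max_integrable n fi.
have iFS n := integrable_preserving (iF n).
have int_ge0 n : (0 <= \int[Q]_x g n x)%E.
  rewrite /g; under eq_integral do rewrite EFinB.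
  rewrite integralB_EFin//; [|exact: iFS].
  rewrite integral_preserving// -integralB_EFin//.
  by apply: integral_ge0 => x _; rewrite lee_fin subr_ge0 run_max_ndS.
have mg n : measurable_fun setT (g n).
  have mF k : measurable_fun setT (run_max f k).
    by apply/measurable_EFinP; exact: measurable_int (iF k).
  apply/measurable_EFinP/measurable_funB; first exact: mF.
  exact: (measurableT_comp (mF n) mS).
have [_ _ cv] : [/\ Q.-integrable setT (EFin \o f),
    [sequence \int[Q]_x `|g n x - (f x)%:E|]_n @ \oo --> 0 &
    [sequence \int[Q]_x g n x]_n @ \oo --> \int[Q]_x (f x)%:E]%E.
  apply: (@dominated_convergence _ _ _ _ _ _ _ _
     (fun x => `|(f x)%:E| + `|(f (S x))%:E|)%E) => //.
  - exact: measurable_int fi.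
  (* By invariance the runs at [S x] are unbounded too; once they are nonnegative, [g n x] equals
     [f x] exactly. *)
  - have : {ae Q, forall x, unbounded_run f x}.
      exists (~` unbounded_run f); split=> //; first exact: measurableC.
      by rewrite probability_setC// C1 subee.
    apply: filterS => x; rewrite -unbounded_run_invariant => /(_ 0%N)[n0 n0P] _.
    apply: cvg_near_cst; exists n0 => // n /= n0n; rewrite /g/=.
    have h : 0 <= run_max f n (S x) by rewrite (le_trans (ltW n0P))// run_max_nd.
    by rewrite (max_idPr h) addrK.
  - apply: integrableD => //; apply: integrable_abse => //.
    exact: integrable_preserving.
  (* [g n x] is [f x] plus the negative part of [run_max f n (S x)], and this run is at least its
     value [f (S x)] at index 0. *)
  - apply: aeW => x n _; rewrite /g /= -EFinD lee_fin.
    have h := @run_max_nd f (S x) 0 n isT; rewrite /= in h.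
    have h1 := ler_norm (- f (S x)); rewrite normrN in h1.
    rewrite -addrA; apply: (le_trans (ler_normD _ _)); rewrite lerD2l.
    case: (lerP 0 (run_max f n (S x))) => h2; first by rewrite subrr normr0.
    by rewrite sub0r ger0_norm; lra.
have : (0 <= \int[Q]_x (f x)%:E)%E.
  by apply: (cvge_ge _ cv); apply: nearW => n; exact: int_ge0.
by rewrite leNgt fneg.
Qed.

(** Centring [f] at its mean plus [e / 2] makes the mean negative, so the sums of [g] stay below
    some [M]; divided by [n], this bound drops below [e / 2]. *)
Lemma birkhoff_upper (f : T -> R) (e : R) :
  Q.-integrable setT (EFin \o f) -> 0 < e ->
  {ae Q, forall x, \forall n \near \oo,
     n%:R^-1 * \sum_(j < n) f (iter j S x) <= fine (\int[Q]_x (f x)%:E)%E + e}.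
Proof.
move=> fi e0; set a := fine _.
have aE : (\int[Q]_x (f x)%:E)%E = a%:E by rewrite fineK// integrable_fin_num.
pose g x := f x - (a + e / 2).
have ci : Q.-integrable setT (EFin \o (fun=> a + e / 2)).
  exact: finite_measure_integrable_cst.
have gi : Q.-integrable setT (EFin \o g).
  have -> : EFin \o g = ((EFin \o f) \- (EFin \o (fun=> (a + e / 2)%R)))%E by [].
  exact: integrableB.
have gneg : (\int[Q]_x (g x)%:E < 0)%E.
  under eq_integral do rewrite EFinB.
  have Q1 : Q setT = 1%E := probability_setT Q.
  rewrite integralB_EFin//= integral_cst//= Q1 mule1 aE -EFinB lte_fin.
  lra.
apply: filterS (negative_mean_bounded_run gi gneg) => x [M HM].
exists (Num.truncn (M%:R * 2 / e)).+1 => //= n nM.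
have n0 : (0 < n)%N by exact: leq_ltn_trans nM.
have n0R : (0 : R) < n%:R by rewrite ltr0n.
have := le_trans (run_max_ge_sum g n.-1 x) (HM n.-1).
rewrite prednK// /g big_split/= sumr_const card_ord -mulr_natl => h.
rewrite mulrC ler_pdivrMr//.
have h1 := truncnS_gt (M%:R * 2 / e).
have : M%:R * 2 / e <= n%:R.
  by rewrite (le_trans (ltW h1))// ler_nat.
rewrite ler_pdivrMr// => h2.
nra.
Qed.

(** The upper bounds for [f] and [- f] squeeze the averages; taking [e] among the [1 / (p + 1)]
    leaves only countably many null sets. *)
Theorem birkhoff (f : T -> R) : Q.-integrable setT (EFin \o f) ->
  {ae Q, forall x, (fun n => n%:R^-1 * \sum_(j < n) f (iter j S x)) @ \oo -->
     fine (\int[Q]_x (f x)%:E)%E}.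
Proof.
move=> fi; set a := fine _.
have e0 (p : nat) : 0 < p.+1%:R^-1 :> R by rewrite invr_gt0 ltr0n.
have up := ae_foralln (fun p => birkhoff_upper fi (e0 p)).
have nfi : Q.-integrable setT (EFin \o (\- f)).
  have -> : EFin \o (\- f) = (-%E \o (EFin \o f))%E by [].
  exact: integrableN.
have dn := ae_foralln (fun p => birkhoff_upper nfi (e0 p)).
have intN : (\int[Q]_x ((\- f) x)%:E)%E = (- a%:E)%E.
  rewrite /a fineK ?integrable_fin_num//.
  by under eq_integral do rewrite /= EFinN; rewrite integralN//; exact: integrable_add_def.
apply: filterS2 up dn => x up dn; apply/cvgrPdist_le => e e_gt0.
pose p := Num.truncn e^-1.
have pe : p.+1%:R^-1 <= e.
  by rewrite -[leRHS]invrK lef_pV2 ?posrE ?invr_gt0 ?ltr0n// ltW// truncnS_gt.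
near=> n.
have h1 : n%:R^-1 * \sum_(j < n) f (iter j S x) <= a + p.+1%:R^-1.
  by near: n; exact: up.
have h2 : n%:R^-1 * \sum_(j < n) (\- f) (iter j S x) <= - a + p.+1%:R^-1.
  by near: n; have := dn p; rewrite intN/=.
rewrite /= sumrN mulrN in h2.
apply: le_trans pe; move: h1 h2.
move: (n%:R^-1 * _) (p.+1%:R^-1 : R) => s u h1 h2.
by rewrite ler_norml; apply/andP; split; lra.
Unshelve. all: by end_near.
Qed.

End Birkhoff.

(** * Stationary processes and their path space *)

Section PathSpace.
Variables (R : realType) (d : nat).

(** The generators of [borelRd] and, next, of [path_sigma] get names so that [g_sigma_algebraType]
    can turn them into measurable types. *)
Definition Rd_gens : set (set (Rd R d)) :=
  [set C | exists (j : 'I_d) (B : set R), measurable B /\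
                  C = [set y : Rd R d | B (y j)]].

Definition path_gens : set (set (pathT R d)) :=
  [set C | exists (i : nat) (j : 'I_d) (B : set R), measurable B /\
                  C = [set z : pathT R d | B ((z i).1 j)]]
      `|` [set C | exists (i : nat) (B : set R), measurable B /\
                  C = [set z : pathT R d | B (z i).2]].

Local Notation RdM := (g_sigma_algebraType Rd_gens).
Local Notation pathM := (g_sigma_algebraType path_gens).

Lemma measurable_pathX i : measurable_fun setT (fun z : pathM => (z i).1 : RdM).
Proof.
apply: (@measurability _ _ pathM RdM _ _ Rd_gens) => // _ [_ [j [B [mB ->]]] <-].
rewrite setTI; apply: sub_sigma_algebra; left; exists i, j, B; split => //.
Qed.

Lemma measurable_pathY i : measurable_fun setT (fun z : pathM => (z i).2).
Proof.
move=> _ B mB; rewrite setTI; apply: sub_sigma_algebra; right; exists i, B; split => //.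
Qed.

Lemma measurable_shift : measurable_fun setT (@Defs.shift R d : pathM -> pathM).
Proof.
apply: (@measurability _ _ pathM pathM _ _ path_gens) => // _
  [_ [[i [j [B [mB ->]]]]|[i [B [mB ->]]]] <-];
  rewrite setTI; apply: sub_sigma_algebra.
- by left; exists i.+1, j, B.
- by right; exists i.+1, B.
Qed.

Lemma iter_shift j (z : pathT R d) i : iter j (@Defs.shift R d) z i = z (j + i)%N.
Proof. by elim: j i => [//|j IH] i; rewrite /= /Defs.shift IH addnS. Qed.

End PathSpace.

Local Notation RdM R d := (g_sigma_algebraType (@Rd_gens R d)).
Local Notation pathM R d := (g_sigma_algebraType (@path_gens R d)).

(** * Transfer of the ergodic theorem from path space to the process *)

Section Process.
Context {R : realType} {d : nat} {dO : measure_display} {Omega : measurableType dO}.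
Variables (P : probability Omega R) (X : nat -> Omega -> Rd R d) (Y : nat -> Omega -> R).
Hypothesis mX : forall i (j : 'I_d), measurable_fun setT (fun w => X i w j).
Hypothesis mY : forall i, measurable_fun setT (Y i).

Lemma measurable_X i : measurable_fun setT (X i : Omega -> RdM R d).
Proof.
apply: (@measurability _ _ Omega (RdM R d) _ _ (@Rd_gens R d)) => // _ [_ [j [B [mB ->]]] <-].
exact: mX.
Qed.

Lemma measurable_path : measurable_fun setT (Defs.path X Y : Omega -> pathM R d).
Proof.
apply: (@measurability _ _ Omega (pathM R d) _ _ (@path_gens R d)) => // _
  [_ [[i [j [B [mB ->]]]]|[i [B [mB ->]]]] <-].
- exact: mX.
- exact: mY.
Qed.

Lemma measurable_X_preimage C : borelRd C -> measurable (X 0%N @^-1` C).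
Proof. by move=> bC; rewrite -[X in measurable X]setTI; exact: measurable_X. Qed.

Lemma measurable_indic_borel C : borelRd C -> measurable_fun setT (\1_C : RdM R d -> R).
Proof. by move=> bC; exact: measurable_indic. Qed.

Hypothesis stat : stationary P X Y.
Hypothesis erg : ergodic P X Y.

(** The law of the path is a shift-invariant, ergodic probability on path space; the null set that
    Birkhoff's theorem gives there is pulled back along the path map. *)
Lemma ergodic_averages (f : pathM R d -> R) :
  measurable_fun setT f ->
  P.-integrable setT (fun w => (f (Defs.path X Y w))%:E) ->
  {ae P, forall w,
     (fun n => n%:R^-1 * \sum_(j < n) f (iter j (@Defs.shift R d) (Defs.path X Y w))) @ \oo -->
     fine (\int[P]_w (f (Defs.path X Y w))%:E)%E}.
Proof.
move=> mf fi; have mf' : measurable_fun setT (EFin \o f) by exact/measurable_EFinP.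
pose mp := isMeasurableFun.Build _ _ _ _ (Defs.path X Y : Omega -> pathM R d) measurable_path.
pose p : {mfun Omega >-> pathM R d} := HB.pack (Defs.path X Y) mp.
pose Q := distribution P p.
have Qi : Q.-integrable setT (EFin \o f).
  exact: (integrable_pushforward measurable_path).
have := @birkhoff _ _ _ Q _ (@measurable_shift R d) _ _ f Qi.
rewrite (_ : (\int[Q]_x (f x)%:E)%E = (\int[P]_w (f (Defs.path X Y w))%:E)%E); last first.
  exact: (integral_pushforward measurable_path).
move=> [||N [mN QN NP]].
- by move=> C mC; apply/esym; exact: stat.
- by move=> C mC; exact: erg.
exists (Defs.path X Y @^-1` N); split => //.
  by rewrite -[X in measurable X]setTI; exact: measurable_path.
by move=> w /= h; apply: NP.
Qed.

Lemma cell_frequency_cvg (C : set (Rd R d)) : borelRd C ->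
  {ae P, forall w, (fun n => n%:R^-1 * \sum_(j < n) \1_C (X j w)) @ \oo -->
     fine (P (X 0%N @^-1` C))}.
Proof.
move=> bC; have mC := measurable_X_preimage bC.
have := @ergodic_averages (fun z => \1_C (z 0%N).1).
have -> : (\int[P]_w (\1_C (Defs.path X Y w 0%N).1)%:E)%E = P (X 0%N @^-1` C).
  by rewrite -[X in P X]setIT -integral_indic//; exact: eq_integral.
move=> H; apply: filterS (H _ _).
- by move=> w; under eq_fun do under eq_bigr do rewrite iter_shift addn0.
- exact: (measurableT_comp (measurable_indic_borel bC) (measurable_pathX _)).
- exact: (integrable_indic P mC).
Qed.

Hypothesis iY : P.-integrable setT (fun w => (Y 0%N w)%:E).

Lemma cell_sum_cvg (C : set (Rd R d)) : borelRd C ->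
  {ae P, forall w, (fun n => n%:R^-1 * \sum_(j < n) Y j w * \1_C (X j w)) @ \oo -->
     fine (\int[P]_(w in X 0%N @^-1` C) (Y 0%N w)%:E)%E}.
Proof.
move=> bC; have mC := measurable_X_preimage bC.
have := @ergodic_averages (fun z => (z 0%N).2 * \1_C (z 0%N).1).
(* The integrand is [Y 0] extended by zero off the preimage of [C], so its mean is the integral over
   that preimage. *)
have eqr : (fun w => ((Defs.path X Y w 0%N).2 * \1_C (Defs.path X Y w 0%N).1)%:E) =
   ((fun w => (Y 0%N w)%:E) \_ (X 0%N @^-1` C)).
  apply/funext => w; rewrite patchE /= indicE.
  have -> : (w \in X 0%N @^-1` C) = (X 0%N w \in C) by apply/idP/idP; rewrite !inE.
  by case: ifP; rewrite ?mulr1 ?mulr0.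
rewrite eqr -integral_mkcond.
move=> H; apply: filterS (H _ _).
- by move=> w; under eq_fun do under eq_bigr do rewrite iter_shift addn0.
- apply: measurable_funM; first exact: measurable_pathY.
  exact: (measurableT_comp (measurable_indic_borel bC) (measurable_pathX _)).
- move: (integrableS measurableT mC (@subsetT _ _) iY) => /(integrable_mkcond _ mC); exact.
Qed.

End Process.

(** * Cells and clipped series *)

Section Cells.
Variables (R : realType) (d : nat) (A : nat -> Rd R d -> set (Rd R d)).
Hypothesis hA : nested_cube_partitions A.

Lemma cell_eq_pred k x y : (1 <= k)%N -> A k.+1 y = A k.+1 x -> A k y = A k x.
Proof.
case: hA => mem eqA _ _ nest k1 e; apply: eqA => //; apply: nest => //.
by rewrite -e; exact: mem.
Qed.

(** The mesh is half the side of a cell of level [k], so every open cell cube contains such a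
    point. *)
Definition grid_point (k : nat) (z : 'I_d -> int) : Rd R d :=
  fun j => (z j)%:~R * 2 ^- k.+3.

(** Rounding the corner up strictly gives a grid point in the open cube, which lies in the cell
    whatever its boundary faces; both points lie in the closed cube, whence the distance bound. *)
Lemma cell_grid_point k x : (1 <= k)%N -> exists z : {ffun 'I_d -> int},
  A k (grid_point k z) = A k x /\ forall j, `|grid_point k z j - x j| <= 2 ^- k.+2.
Proof.
case: hA => mem eqA cub _ _ k1.
have [a [aA Aa]] := cub k x k1.
pose s : R := 2 ^- k.+3.
have s0 : 0 < s by rewrite invr_gt0 exprn_gt0.
have hs : 2 ^- k.+2 = s + s :> R.
  have -> : s = 2^-1 * 2 ^- k.+2 by rewrite /s exprS invfM.
  by rewrite -mulrDl -[in RHS](div1r 2) -splitr mul1r.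
pose z := [ffun j => Num.floor (a j / s) + 1].
have zP j : a j < grid_point k z j <= a j + s.
  rewrite /grid_point ffunE -/s.
  have := floor_le (a j / s); have := floorD1_gt (a j / s).
  rewrite ltr_pdivrMr// ler_pdivlMr// intrD => h1 h2.
  by apply/andP; split; [exact: h1|rewrite mulrDl mul1r lerD2r].
exists z; split.
  by apply: eqA => //; apply: aA => j; have /andP[h1 h2] := zP j; rewrite h1 hs /=; lra.
move=> j; have /andP[h1 h2] := zP j; have /andP[h3 h4] := Aa _ (mem k x k1) j.
move: h1 h2 h3 h4; rewrite hs; move: (grid_point _ _ _) => g *.
by rewrite ler_norml; apply/andP; split; lra.
Qed.

Lemma countable_cells : exists q : nat -> nat -> Rd R d,
  forall k x, (1 <= k)%N -> exists i, A k (q k i) = A k x.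
Proof.
(* Grid points are enumerated through their codes; [point] fills the indices that decode to
   nothing. *)
exists (fun k i =>
  if @unpickle {ffun 'I_d -> int} i is Some z then grid_point k z else point) => k x k1.
have [z [zx _]] := cell_grid_point x k1.
by exists (pickle z); rewrite pickleK.
Qed.

Lemma finite_cells k (r : R) : (1 <= k)%N ->
  exists (I : finType) (p : I -> Rd R d), forall x, (forall j, `|x j| <= r) ->
    exists i, A k (p i) = A k x.
Proof.
(* The grid point is within 1 of [x], so its integer coordinates are below [M.+1] in absolute value;
   adding [M.+1] places them in ['I_(M + M).+2]. *)
move=> k1; pose M := Num.truncn ((r + 1) * 2 ^+ k.+3).
exists {ffun 'I_d -> 'I_(M + M).+2}.
exists (fun c : {ffun 'I_d -> 'I_(M + M).+2} =>
  grid_point k (fun j => (c j)%:Z - M.+1%:Z)) => x xr.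
have [z [<- zx]] := cell_grid_point x k1.
have zM j : (0 <= z j + M.+1%:Z < (M + M).+2%:Z)%R.
  have h2 : (2 : R) ^- k.+2 <= 1 by rewrite invf_le1 ?exprn_gt0// exprn_ege1// ler1n.
  have h : `|(z j)%:~R * 2 ^- k.+3 : R| <= r + 1.
    have := zx j; have := xr j; rewrite /grid_point => h0 h1.
    have := ler_normD ((z j)%:~R * 2 ^- k.+3 - x j) (x j); rewrite subrK; lra.
  rewrite normrM (gtr0_norm (_ : 0 < 2 ^- k.+3)) ?invr_gt0 ?exprn_gt0// in h.
  rewrite ler_pdivrMr ?exprn_gt0// in h.
  have {}h := le_lt_trans h (truncnS_gt _).
  rewrite -intr_norm -/M -[_%:R]/(M.+1%:Z%:~R) ltr_int in h.
  lia.
clearbody M.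
exists [ffun j => inord (absz (z j + M.+1%:Z))]; congr (A k _); apply/funext => j.
have /andP[h1 h2] := zM j.
rewrite /grid_point ffunE inordK; last first.
  lia.
by congr (_%:~R * _); lia.
Qed.

End Cells.

(** * Clipping and the convergence of clipped series *)

Section Clip.
Variable R : realType.
Implicit Types (L t u : R) (k n : nat).

(** Clipping is projection onto an interval centred at 0; in this form its bound and Lipschitz
    property are linear case checks. *)
Lemma clipE L k t : 0 <= L -> clip L k t = Num.max (- (L * 2 ^- k)) (Num.min t (L * 2 ^- k)).
Proof.
move=> L0; rewrite /clip; set c := L * _.
have c0 : 0 <= c by rewrite mulr_ge0// invr_ge0 exprn_ge0.
case: (sgrP t) => [->|t0|t0].
- by rewrite mul0r (min_idPl c0); case: lerP => //; lra.
- rewrite mul1r; case: (lerP t c) => h; case: lerP => //; lra.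
- case: (lerP t c) => h; case: (lerP (- t) c) => h1; rewrite ?mulN1r ?opprK; case: lerP; lra.
Qed.

Lemma clip_le L k t : 0 <= L -> `|clip L k t| <= L * 2 ^- k.
Proof.
move=> L0; rewrite clipE//; set c := L * _.
have c0 : 0 <= c by rewrite mulr_ge0// invr_ge0 exprn_ge0.
rewrite ler_norml; apply/andP; split; first by rewrite le_max lexx.
by rewrite ge_max ge_min lexx orbT andbT; lra.
Qed.

Lemma clip_lipschitz L k t u : 0 <= L -> `|clip L k t - clip L k u| <= `|t - u|.
Proof.
move=> L0; rewrite !clipE//; set c := L * _.
have c0 : 0 <= c by rewrite mulr_ge0// invr_ge0 exprn_ge0.
have : - `|t - u| <= t - u <= `|t - u| by rewrite -ler_norml.
case/andP; move: (`|t - u|) => D h1 h2.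
rewrite ler_norml; apply/andP.
case: (lerP t c) => ?; case: (lerP u c) => ?; case: (lerP (- c) c) => ?;
  case: (lerP (- c) t) => ?; case: (lerP (- c) u) => ?; split; lra.
Qed.

Lemma geometric_tail_le L m n : 0 <= L -> \sum_(m <= k < n) L * 2 ^- k <= 2 * (L * 2 ^- m).
Proof.
move=> L0; have [nm|mn] := leqP n m.
  by rewrite big_geq// !mulr_ge0// invr_ge0 exprn_ge0.
suff -> : \sum_(m <= k < n) L * 2 ^- k = 2 * (L * 2 ^- m) - 2 * (L * 2 ^- n).
  by rewrite gerBl !mulr_ge0// invr_ge0 exprn_ge0.
(* Each term is [2 * (L * 2 ^- k) - 2 * (L * 2 ^- k.+1)], so the sum telescopes. *)
rewrite -opprB -(@telescope_sumr _ _ _ (fun k => 2 * (L * 2 ^- k)) (ltnW mn)) -sumrN.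
apply: eq_bigr => k _; rewrite [2 ^+ k.+1]exprS invfM; move: (2 ^- k) => v.
have : (2 : R)^-1 = 1 / 2 by rewrite div1r.
lra.
Qed.

Lemma clipped_sum_le L (t : nat -> R) m n : 0 <= L ->
  `|\sum_(m <= k < n) clip L k (t k)| <= 2 * (L * 2 ^- m).
Proof.
move=> L0; apply: le_trans (geometric_tail_le m n L0).
apply: le_trans (ler_norm_sum _ _ _) _; apply: ler_sum => k _; exact: clip_le.
Qed.

(** The factor 4 covers two tails, of the estimator and of the limit, each at most
    [2 * (L * 2 ^- K)]. *)
Lemma geometric_small L e : 0 < e -> exists2 K, (2 <= K)%N & 4 * (L * 2 ^- K) <= e.
Proof.
move=> e0; have := truncnS_gt (4 * L / e); set t := Num.truncn _ => h.
exists t.+2 => //.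
rewrite mulrA ler_pdivrMr ?exprn_gt0// -ler_pdivrMl// mulrC.
apply: (le_trans (ltW h)).
rewrite -natrX ler_nat; apply: leq_trans (ltnW (ltn_expl t.+2 (ltnSn 1))).
exact: leqnSn.
Qed.

Lemma clipped_series_cvg L (t : nat -> R) : 0 <= L ->
  cvgn (fun n => \sum_(2 <= k < n) clip L k (t k)).
Proof.
move=> L0; apply/cauchy_cvgP/cauchy_exP => e e0.
have [K K2 Ke] := @geometric_small L e e0.
exists (\sum_(2 <= k < K) clip L k (t k)).
exists K.+1 => // n /= Kn; rewrite /ball /=.
rewrite (big_cat_nat _ (ltnW Kn))//= opprD addNKr normrN.
apply: le_lt_trans (clipped_sum_le _ _ _ L0) _.
by lra.
Qed.

Lemma clipped_series_tail L (t : nat -> R) K : 0 <= L -> (2 <= K)%N ->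
  `|limn (fun n => \sum_(2 <= k < n) clip L k (t k)) - \sum_(2 <= k < K) clip L k (t k)|
    <= 2 * (L * 2 ^- K).
Proof.
move=> L0 K2; have cv := @clipped_series_cvg L t L0.
have cv' : (fun n => `|\sum_(2 <= k < n) clip L k (t k) - \sum_(2 <= k < K) clip L k (t k)|)
    @ \oo --> `|limn (fun n => \sum_(2 <= k < n) clip L k (t k))
              - \sum_(2 <= k < K) clip L k (t k)|.
  by apply: cvg_norm; apply: cvgB => //; exact: cvg_cst.
apply: (cvgr_to_le cv'); exists K => // n /= Kn.
rewrite (big_cat_nat K2 Kn)/= addrAC subrr add0r.
exact: clipped_sum_le.
Qed.

(* Tannery's theorem, uniformly over the parameter set [E]. *)
Lemma clipped_series_unif_cvg (T : Type) (E : set T) L (a : nat -> nat -> T -> R)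
    (b : nat -> T -> R) (N : nat -> nat) :
  0 <= L -> N @ \oo --> \oo ->
  (forall k e, (1 <= k)%N -> 0 < e ->
     \forall n \near \oo, forall x, E x -> `|a k n x - b k x| <= e) ->
  forall e, 0 < e -> \forall n \near \oo, forall x, E x ->
    `|a 1%N n x + \sum_(2 <= k < (N n).+1) clip L k (a k n x - a k.-1 n x)
      - (b 1%N x + limn (fun n => \sum_(2 <= k < n) clip L k (b k x - b k.-1 x)))| <= e.
Proof.
move=> L0 Noo ab e e0.
have [K K2 Ke] := @geometric_small L (e / 2) (divr_gt0 e0 (ltr0Sn _ 1)).
(* Half of [e] goes to the tails from [K] on; the rest is shared by level 1, with one error, and at
   most [K] clipped differences, with two errors each. *)
pose u := e / 2 / (K.*2.+1)%:R.
have u0 : 0 < u by rewrite !divr_gt0.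
have uE : u * (K.*2.+1)%:R = e / 2 by rewrite divfK// pnatr_eq0.
near=> n => x Ex.
have abn : forall k : 'I_K, `|a k.+1 n x - b k.+1 x| <= u.
  move: x Ex => x Ex k; move: x Ex; move: k.
  by near: n; apply: filter_forall => k; exact: ab.
have {}abn k : (1 <= k)%N -> (k <= K)%N -> `|a k n x - b k x| <= u.
  by case: k => // k _ kK; exact: (abn (Ordinal kK)).
have KN : (K <= (N n).+1)%N by apply: leqW; near: n; exact: (Noo _ (nbhs_infty_ge K)).
have h1 := abn 1%N isT (ltnW K2).
have h2 := @clipped_series_tail L (fun k => b k x - b k.-1 x) K L0 K2.
have h3 := @clipped_sum_le L (fun k => a k n x - a k.-1 n x) K (N n).+1 L0.
have h4 : `|\sum_(2 <= k < K) clip L k (a k n x - a k.-1 n x)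
            - \sum_(2 <= k < K) clip L k (b k x - b k.-1 x)| <= u * (K.*2)%:R.
  rewrite -sumrB; apply: le_trans (ler_norm_sum _ _ _) _.
  have -> : u * (K.*2)%:R = \sum_(0 <= k < K) (u + u).
    by rewrite sumr_const_nat subn0 -mulr2n -mulrnA mul2n mulr_natr.
  (* The comparison sum has [K] terms; those of index 0 and 1 are nonnegative and are dropped. *)
  rewrite [leRHS](@big_cat_nat _ _ _ 2 0 K)//= -[leLHS]add0r lerD//.
    by apply: sumr_ge0 => k _; rewrite addr_ge0// ltW.
  rewrite big_nat_cond [leRHS]big_nat_cond.
  apply: ler_sum => -[//|[//|k]] /andP[/andP[_ kK] _].
  apply: le_trans (clip_lipschitz _ _ _ L0) _.
  have := abn k.+2 isT (ltnW kK); have := abn k.+1 isT (ltnW (ltnW kK)).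
  rewrite /=; move: (a k.+2 n x) (a k.+1 n x) (b k.+2 x) (b k.+1 x) => q p s r hp hq.
  have -> : q - p - (s - r) = (q - s) - (p - r) by lra.
  by rewrite (le_trans (ler_normB _ _))// lerD.
rewrite -natr1 mulrDr mulr1 in uE.
rewrite (big_cat_nat K2 KN)/=.
move: h1 h2 h3 h4 Ke uE.
move: (limn _) (\sum_(_ <= _ < _) _) (\sum_(_ <= _ < _) _) (\sum_(_ <= _ < _) _).
move: (L * _) (u * _) => c v l s1 s2 s3.
rewrite !ler_norml => /andP[? ?] /andP[? ?] /andP[? ?] /andP[? ?] ? ?.
apply/andP; split; lra.
Unshelve. all: by end_near.
Qed.

End Clip.

(** * The estimator *)

Section Estimator.
Context {R : realType} {d : nat} {dO : measure_display} {Omega : measurableType dO}.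
Variables (P : probability Omega R) (X : nat -> Omega -> Rd R d) (Y : nat -> Omega -> R).
Variables (A : nat -> Rd R d -> set (Rd R d)) (L : R) (N : nat -> nat).
Hypothesis mX : forall i (j : 'I_d), measurable_fun setT (fun w => X i w j).
Hypothesis mY : forall i, measurable_fun setT (Y i).
Hypothesis hA : nested_cube_partitions A.
Hypothesis L0 : 0 < L.

Lemma Mhat_cell k n w x y : A k x = A k y -> Mhat X Y A k n w x = Mhat X Y A k n w y.
Proof. by move=> e; rewrite /Mhat e. Qed.

Lemma Mk_cell k x y : A k x = A k y -> Mk P X Y A k x = Mk P X Y A k y.
Proof. by move=> e; rewrite /Mk e. Qed.

Lemma borel_cell k x : (1 <= k)%N -> borelRd (A k x).
Proof. by case: hA => _ _ _ bA _; exact: bA. Qed.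

Lemma measurable_cell k x : (1 <= k)%N -> measurable (X 0%N @^-1` A k x).
Proof. by move=> k1; apply: measurable_X_preimage => //; exact: borel_cell. Qed.

(** Dividing sum and count by [n] turns [Mhat] into a ratio of convergent averages; the positive
    limit of the frequency keeps the count nonzero for large [n]. *)
Lemma Mhat_cvg k w x : (1 <= k)%N -> (0 < P (X 0%N @^-1` A k x))%E ->
  (fun n => n%:R^-1 * \sum_(j < n) \1_(A k x) (X j w)) @ \oo --> fine (P (X 0%N @^-1` A k x)) ->
  (fun n => n%:R^-1 * \sum_(j < n) Y j w * \1_(A k x) (X j w)) @ \oo -->
     fine (\int[P]_(w in X 0%N @^-1` A k x) (Y 0%N w)%:E)%E ->
  (fun n => Mhat X Y A k n w x) @ \oo --> Mk P X Y A k x.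
Proof.
move=> k1 P0 cf cs; set p := fine (P _) in cf *.
have p0 : 0 < p.
  apply: fine_gt0; rewrite P0/=.
  exact: le_lt_trans (probability_le1 P (measurable_cell x k1)) (ltry 1).
have c : (fun n => (n%:R^-1 * \sum_(j < n) Y j w * \1_(A k x) (X j w)) *
    (n%:R^-1 * \sum_(j < n) \1_(A k x) (X j w))^-1) @ \oo --> Mk P X Y A k x.
  by apply: cvgM => //; apply: cvgV => //; exact: lt0r_neq0.
apply: cvg_trans c; apply: near_eq_cvg.
move: cf => /cvgr_gt /(_ _ p0); apply: filterS2 (nbhs_infty_gt 0%N) => n n0 h.
have n0R : n%:R != 0 :> R by rewrite pnatr_eq0 -lt0n.
rewrite /Mhat /=; case: eqP => [e|/eqP e]; first by rewrite e mulr0 ltxx in h.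
by rewrite invfM mulrACA divff ?mul1r ?invr_eq0.
Qed.

(** Preimages under a function constant on cells are countable unions of cell events. *)
Lemma measurable_cell_fun k (g : Rd R d -> R) : (1 <= k)%N ->
  (forall x y, A k x = A k y -> g x = g y) ->
  measurable_fun setT (fun w => g (X 0%N w)).
Proof.
move=> k1 gA _ B mB; rewrite setTI.
have [q qP] := countable_cells hA.
rewrite (_ : _ @^-1` _ = \bigcup_i (X 0%N @^-1` A k (q k i) `&` [set w | B (g (q k i))])).
  apply: bigcupT_measurable => i; apply: measurableI; first exact: measurable_cell.
  have [h|h] := pselect (B (g (q k i))).
    by rewrite (_ : [set _ | _] = setT)//; apply/seteqP; split.
  by rewrite (_ : [set _ | _] = set0)//; apply/seteqP; split.
case: hA => mem eqA _ _ _.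
apply/seteqP; split => [w /= Bw|w [i _ [/= Aw Bw]]].
  have [i e] := qP k (X 0%N w) k1; exists i => //=; rewrite (gA _ _ e) e; split => //.
  exact: mem.
by rewrite /= (gA _ (q k i))//; apply: eqA.
Qed.

Lemma measurable_clipped_sum (M : nat -> Rd R d -> R) n :
  (forall k x y, A k x = A k y -> M k x = M k y) ->
  measurable_fun setT (fun w => M 1%N (X 0%N w) +
    \sum_(2 <= k < n) clip L k (M k (X 0%N w) - M k.-1 (X 0%N w))).
Proof.
move=> MA; apply: measurable_funD.
  by apply: (@measurable_cell_fun 1%N (M 1%N)) => // x y; exact: MA.
under eq_fun do rewrite -[2%N]add0n big_addn big_mkord.
apply: measurable_sum => k; rewrite addn2/=.
apply: (@measurable_cell_fun k.+2 (fun x => clip L k.+2 (M k.+2 x - M k.+1 x))) => // x y e.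
by rewrite (MA _ _ _ e) (MA k.+1 x y)//; exact: (cell_eq_pred hA).
Qed.

Lemma measurable_mhat n w : measurable_fun setT (fun w' => mhat X Y A L N n w (X 0%N w')).
Proof.
apply: (@measurable_clipped_sum (fun k => Mhat X Y A k n w)) => k x y.
exact: Mhat_cell.
Qed.

Lemma measurable_mL : measurable_fun setT (fun w' => mL P X Y A L (X 0%N w')).
Proof.
apply: (@measurable_fun_cvg _ _ _ _ (fun n w' => Mk P X Y A 1 (X 0%N w') +
   \sum_(2 <= k < n) clip L k (Mk P X Y A k (X 0%N w') - Mk P X Y A k.-1 (X 0%N w')))).
  move=> n; apply: measurable_clipped_sum => k x y; exact: Mk_cell.
move=> w _; apply: cvgD; first exact: cvg_cst.
by apply: clipped_series_cvg; exact: ltW.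
Qed.

(** A point off the support lies in a cell of mass zero, and there are countably many cells in
    all. *)
Lemma supp_ae : {ae P, forall w, supp P X A (X 0%N w)}.
Proof.
have [q qP] := countable_cells hA.
have H k i : {ae P, forall w, (1 <= k)%N -> A k (q k i) (X 0%N w) ->
    (0 < P (X 0%N @^-1` A k (q k i)))%E}.
  have [k0|k1] := posnP k; first by apply: aeW => w; rewrite k0.
  have [P0|P0] := eqVneq (P (X 0%N @^-1` A k (q k i))) 0%E; last first.
    by apply: aeW => w _ _; rewrite lt0e P0 measure_ge0.
  exists (X 0%N @^-1` A k (q k i)); split => //; first exact: measurable_cell.
  by move=> w /= /not_implyP[_ /not_implyP[]].
have {}H := ae_foralln (fun k => ae_foralln (H k)).
case: hA => mem eqA _ _ _.
apply: filterS H => w H k k1.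
have [i e] := qP k (X 0%N w) k1.
by rewrite -e; apply: H => //; rewrite e; exact: mem.
Qed.

(** An almost sure event is inhabited. A support point makes the supremum of the errors nonnegative,
    where an empty set would give [-oo]. *)
Lemma supp_nonempty : supp P X A !=set0.
Proof.
have PF : ProperFilter (almost_everywhere P).
  by apply: ae_properfilter_algebraOfSetsType; rewrite [X in (0 < X)%E]probability_setT.
have [w hw] := filter_ex supp_ae.
by exists (X 0%N w).
Qed.

(** * Almost sure convergence of the estimator on the support *)

Hypothesis stat : stationary P X Y.
Hypothesis erg : ergodic P X Y.
Hypothesis iY : P.-integrable setT (fun w => (Y 0%N w)%:E).

(** [Mhat] and [Mk] see [x] only through its cell; one representative per cell leaves countably many
    null sets, so a single event serves every [x]. *)
Lemma Mhat_cvg_ae : {ae P, forall w, forall k x, (1 <= k)%N -> supp P X A x ->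
  (fun n => Mhat X Y A k n w x) @ \oo --> Mk P X Y A k x}.
Proof.
have [q qP] := countable_cells hA.
have H k i : {ae P, forall w, (1 <= k)%N -> (0 < P (X 0%N @^-1` A k (q k i)))%E ->
    (fun n => Mhat X Y A k n w (q k i)) @ \oo --> Mk P X Y A k (q k i)}.
  have [k0|k1] := posnP k; first by apply: aeW => w; rewrite k0.
  have bC := borel_cell (q k i) k1.
  apply: filterS2 (cell_frequency_cvg mX mY stat erg bC) (cell_sum_cvg mX mY stat erg iY bC).
  by move=> w h1 h2 _ P0; exact: (Mhat_cvg k1).
have {}H := ae_foralln (fun k => ae_foralln (H k)).
apply: filterS H => w H k x k1 Sx.
have [i e] := qP k x k1.
under eq_fun do rewrite -(Mhat_cell _ _ e).
rewrite -(Mk_cell e); apply: H => //.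
by rewrite e; exact: Sx.
Qed.

Hypothesis Noo : N @ \oo --> \oo.

Lemma mhat_cvg w :
  (forall k x, (1 <= k)%N -> supp P X A x ->
    (fun n => Mhat X Y A k n w x) @ \oo --> Mk P X Y A k x) ->
  forall x, supp P X A x -> (fun n => mhat X Y A L N n w x) @ \oo --> mL P X Y A L x.
Proof.
move=> H x Sx; apply/cvgrPdist_le => e e0.
have Hx k u : (1 <= k)%N -> 0 < u -> \forall n \near \oo, forall y, [set x] y ->
    `|Mhat X Y A k n w y - Mk P X Y A k y| <= u.
  move=> k1 u0; have /cvgrPdist_le /(_ _ u0) := H k x k1 Sx.
  by apply: filterS => n h y ->; rewrite distrC.
have := clipped_series_unif_cvg (ltW L0) Noo Hx e0.
by apply: filterS => n /(_ x erefl); rewrite distrC.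
Qed.

(** A bounded support meets finitely many cells at each level, so convergence cell by cell is
    uniform over the support, as Tannery's theorem asks. *)
Lemma mhat_unif_cvg w r : (forall x, supp P X A x -> forall j, `|x j| <= r) ->
  (forall k x, (1 <= k)%N -> supp P X A x ->
    (fun n => Mhat X Y A k n w x) @ \oo --> Mk P X Y A k x) ->
  forall e, 0 < e -> \forall n \near \oo, forall x, supp P X A x ->
    `|mhat X Y A L N n w x - mL P X Y A L x| <= e.
Proof.
move=> Sr H; apply: clipped_series_unif_cvg => //; first exact: ltW.
move=> k e k1 e0; have [I [p pP]] := finite_cells hA r k1.
(* Cells that miss the support are exempted, since convergence is given only at support points. *)
have : forall i, \forall n \near \oo, (exists2 x, supp P X A x & A k (p i) = A k x) ->
    `|Mhat X Y A k n w (p i) - Mk P X Y A k (p i)| <= e.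
  move=> i; have [[x Sx px]|no] :=
    pselect (exists2 x, supp P X A x & A k (p i) = A k x); last by apply: nearW.
  have /cvgrPdist_le /(_ _ e0) := H k x k1 Sx.
  by apply: filterS => n h _; rewrite (Mhat_cell _ _ px) (Mk_cell px) distrC.
move=> /filter_forall; apply: filterS => n h x Sx.
have [i px] := pP x (Sr x Sx).
by rewrite -(Mhat_cell _ _ px) -(Mk_cell px); apply: h; exists x.
Qed.

Lemma sup_error_cvg w :
  (forall e, 0 < e -> \forall n \near \oo, forall x, supp P X A x ->
    `|mhat X Y A L N n w x - mL P X Y A L x| <= e) ->
  (fun n => ereal_sup [set (`|mhat X Y A L N n w x - mL P X Y A L x|)%:E | x in supp P X A])
    @ \oo --> 0%E.
Proof.
move=> H; set s := (fun n => _).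
have s0 n : (0 <= s n)%E.
  have [x Sx] := supp_nonempty.
  apply: (@le_trans _ _ (`|mhat X Y A L N n w x - mL P X Y A L x|)%:E) => //.
  by apply: ereal_sup_ubound; exists x.
have se e : 0 < e -> \forall n \near \oo, (s n <= e%:E)%E.
  move=> e0; apply: filterS (H e e0) => n h.
  by apply: ge_ereal_sup => _ [x Sx <-]; rewrite lee_fin h.
apply/fine_cvgP; split.
  apply: filterS (se 1 ltr01) => n h.
  by rewrite ge0_fin_numE// (le_lt_trans h)// ltry.
apply/cvgrPdist_le => e e0; apply: filterS (se e e0) => n h /=.
rewrite sub0r normrN ger0_norm ?fine_ge0//.
by rewrite -lee_fin fineK// ge0_fin_numE// (le_lt_trans h)// ltry.
Qed.

Lemma square_error_cvg w C :
  (forall x, supp P X A x -> (fun n => mhat X Y A L N n w x) @ \oo --> mL P X Y A L x) ->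
  (\forall n \near \oo, forall x, supp P X A x ->
    `|mhat X Y A L N n w x - mL P X Y A L x| <= C) ->
  (fun n => (\int[P]_w' ((mhat X Y A L N n w (X 0%N w') - mL P X Y A L (X 0%N w')) ^+ 2)%:E)%E)
     @ \oo --> 0%E.
Proof.
move=> H [n0 _ n0P].
(* The index is shifted by [n0] so that the majorant [C ^+ 2] holds along the whole sequence. *)
pose h n w' := (mhat X Y A L N (n + n0) w (X 0%N w') - mL P X Y A L (X 0%N w')) ^+ 2.
have mh n : measurable_fun setT (h n).
  by apply/measurable_funX/measurable_funB; [exact: measurable_mhat|exact: measurable_mL].
have [_ _] : [/\ P.-integrable setT (cst 0%E : Omega -> \bar R),
    [sequence \int[P]_x `|(h n x)%:E - cst 0 x|]_n @ \oo --> 0 &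
    [sequence \int[P]_x (h n x)%:E]_n @ \oo --> \int[P]_x (cst 0 x)]%E.
  apply: (@dominated_convergence _ _ _ _ _ _ _ _ (cst (C ^+ 2)%:E)) => //.
  - by move=> n; apply/measurable_EFinP.
  - apply: filterS supp_ae => w' Sw' _; apply/fine_cvgP; split; first exact: nearW.
    have c : (fun n => mhat X Y A L N (n + n0) w (X 0%N w') - mL P X Y A L (X 0%N w'))
       @ \oo --> (0 : R).
      rewrite -(subrr (mL P X Y A L (X 0%N w'))); apply: cvgB; last exact: cvg_cst.
      by have := H _ Sw'; rewrite -(cvg_shiftn n0).
    by have := cvgM c c; rewrite mulr0; apply.
  - exact: finite_measure_integrable_cst.
  - apply: filterS supp_ae => w' Sw' n _ /=; rewrite lee_fin ger0_norm ?sqr_ge0// /h.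
    rewrite -real_normK ?num_real// lerXn2r ?nnegrE//; last exact: n0P (leq_addl _ _) _ Sw'.
    exact: le_trans (normr_ge0 _) (n0P n0 (leqnn _) _ Sw').
by rewrite integral0 => cv; rewrite -(cvg_shiftn n0).
Qed.

(** * Bounds that make the error integrable in both cases of (c) *)

Lemma Mhat_bound k n w x D : 0 <= D -> (forall i, `|Y i w| <= D) -> `|Mhat X Y A k n w x| <= D.
Proof.
move=> D0 YD; rewrite /Mhat /=; case: eqP => [_|/eqP c0]; first by rewrite normr0.
have i0 j : 0 <= \1_(A k x) (X j w) :> R by rewrite indicE.
have cp : 0 < \sum_(j < n) \1_(A k x) (X j w) :> R.
  by rewrite lt0r c0/=; apply: sumr_ge0.
rewrite normrM normfV (gtr0_norm cp) ler_pdivrMr// mulr_sumr.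
apply: le_trans (ler_norm_sum _ _ _) _; apply: ler_sum => j _.
by rewrite normrM (ger0_norm (i0 j)) ler_wpM2r.
Qed.

Lemma mhat_bound n w x D : 0 <= D -> (forall i, `|Y i w| <= D) ->
  `|mhat X Y A L N n w x| <= D + L.
Proof.
move=> D0 YD; apply: le_trans (ler_normD _ _) _; apply: lerD; first exact: Mhat_bound.
(* The corrections start at level 2 and sum to at most [2 * (L * 2 ^- 2)], which is [L / 2]. *)
apply: le_trans (clipped_sum_le _ _ _ (ltW L0)) _.
rewrite mulrCA ler_piMr ?ltW//.
have : (2 : R) ^- 2 = 1 / 4 by rewrite div1r -natrX.
lra.
Qed.

(** By stationarity the event of exceeding [D] has the same probability at [i] and [i.+1]; it is
    null at 0. *)
Lemma bounded_Y_ae D : {ae P, forall w, `|Y 0%N w| <= D} ->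
  {ae P, forall w, forall i, `|Y i w| <= D}.
Proof.
move=> H; apply: ae_foralln => i.
pose B : set R := [set y | ~ (`|y| <= D)].
have mB : measurable B.
  rewrite (_ : B = ~` [set y | `|y| <= D])//; apply: measurableC.
  rewrite (_ : [set _ | _] = `[- D, D]%classic); first exact: measurable_itv.
  by apply/seteqP; split => y /=; rewrite in_itv/= ler_norml.
have mYB j : measurable (Y j @^-1` B).
  by rewrite -[X in measurable X]setTI; exact: mY.
suff P0 : P (Y i @^-1` B) = 0%E by exists (Y i @^-1` B); split => //.
elim: i => [|i IH]; first exact: (measure_negligible (mYB 0%N) H).
rewrite -[RHS]IH; apply/esym.
apply: (@stat [set z | B (z i).2]).
by apply: sub_sigma_algebra; right; exists i, B.
Qed.

(** The level 1 cell of a support point has positive mass, hence contains some [X 0 w] with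
    coordinates at most [r] in absolute value; its side is 1/8. *)
Lemma supp_bounded r : P [set w | exists j, r < `|X 0%N w j|] = 0%E ->
  forall x, supp P X A x -> forall j, `|x j| <= r + 1.
Proof.
move=> P0 x Sx j.
set E := [set w | _] in P0.
have mE : measurable E.
  have -> : E = \bigcup_(i in [set: 'I_d]) [set w | r < `|X 0%N w i|].
    by apply/seteqP; split => [w [i h]|w [i _ h]]; exists i.
  apply: fin_bigcup_measurable => // i _.
  rewrite -[X in measurable X]setTI.
  have mn : measurable_fun setT (fun w => `|X 0%N w i|) by exact: measurableT_comp.
  have := mn measurableT `]r, +oo[%classic (measurable_itv _).
  by congr (measurable (_ `&` _)); apply/seteqP; split=> w /=; rewrite in_itv/= andbT.
have [w [Aw nE]] : exists w, A 1%N x (X 0%N w) /\ ~ E w.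
  apply: contrapT => no; have := Sx 1%N isT; rewrite lt_neqAle => /andP[/eqP + _]; apply.
  apply/esym/eqP; rewrite -measure_le0 -P0 le_measure ?inE//; first exact: measurable_cell.
  by move=> w /= Aw; apply: contrapT => nE; apply: no; exists w.
case: hA => mem _ cub _ _; have [a [_ Aa]] := cub 1%N x isT.
have /andP[h1 h2] := Aa _ (mem 1%N x isT) j; have /andP[h3 h4] := Aa _ Aw j.
have h5 : `|X 0%N w j| <= r by rewrite leNgt; apply/negP => h; apply: nE; exists j.
have h6 : (2 : R) ^- 3 = 1 / 8 by rewrite div1r -natrX.
move: h1 h2 h3 h4 h5; rewrite h6 !ler_norml => ? ? ? ? /andP[? ?].
by apply/andP; split; lra.
Qed.

End Estimator.

Theorem theorem1 (R : realType) (d : nat)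
  (dO : measure_display) (Omega : measurableType dO) (P : probability Omega R)
  (X : nat -> Omega -> 'I_d -> R) (Y : nat -> Omega -> R)
  (A : nat -> ('I_d -> R) -> set ('I_d -> R)) (L : R) (N : nat -> nat) :
  (forall i (j : 'I_d), measurable_fun setT (fun w => X i w j)) ->
  (forall i, measurable_fun setT (Y i)) ->
  stationary P X Y -> ergodic P X Y ->
  P.-integrable setT (fun w => (Y 0%N w)%:E) ->
  nested_cube_partitions A ->
  0 < L ->
  (forall n, (0 < N n)%N) -> {homo N : m n / (m <= n)%N} ->
  (N @ \oo --> \oo) ->
  let S := supp P X A in
  let m := mL P X Y A L in
  let mh := mhat X Y A L N in
  (* (a) *)
  {ae P, forall w, forall x, S x -> (fun n => mh n w x) @ \oo --> m x}
  /\
  (* (b) *)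
  ((exists r : R, forall x, S x -> forall j, `|x j| <= r) ->
   {ae P, forall w,
      (fun n => ereal_sup [set (`|mh n w x - m x|)%:E | x in S]) @ \oo --> 0%E})
  /\
  (* (c) *)
  (((exists D : R, {ae P, forall w, `|Y 0%N w| <= D}) \/
    (exists r : R, P [set w | exists j, r < `|X 0%N w j|] = 0%E)) ->
   {ae P, forall w,
      (fun n => (\int[P]_w' ((mh n w (X 0%N w') - m (X 0%N w')) ^+ 2)%:E)%E)
        @ \oo --> 0%E}).
Proof.
move=> mX mY stat erg iY hA L0 _ _ Noo S m mh.
(* Convergence on every cell of positive mass is one almost sure event, and it drives all three
   claims. *)
have cvM := Mhat_cvg_ae mX mY hA stat erg iY.
split; [|split].
- by apply: filterS cvM => w cw x Sx; exact: mhat_cvg.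
- move=> [r Sr]; apply: filterS cvM => w cw; apply: sup_error_cvg => //.
  exact: (mhat_unif_cvg hA L0 Noo Sr cw).
- move=> [[D YD]|[r Xr]].
    (* The given [D] carries no sign, while the bounds on the estimator ask for a nonnegative
       constant. *)
    have YD' : {ae P, forall w, `|Y 0%N w| <= Num.max 0 D}.
      by apply: filterS YD => w h; rewrite le_max h orbT.
    apply: filterS2 cvM (bounded_Y_ae mY stat YD') => w cw Yw.
    have cm := mhat_cvg L0 Noo cw.
    have D0 : 0 <= Num.max 0 D by rewrite le_max lexx.
    have mb n x := mhat_bound X A N L0 n x D0 Yw.
    suff near_bound : \forall n \near \oo, forall x, S x ->
        `|mh n w x - m x| <= (Num.max 0 D + L) + (Num.max 0 D + L).
      exact: square_error_cvg near_bound.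
    (* The estimator satisfies [mhat_bound], and its limit [m x] inherits the same bound. *)
    apply: nearW => n x Sx; apply: le_trans (ler_normB _ _) _; apply: lerD => //.
    apply: (cvgr_to_le (cvg_norm (cm x Sx))); exact: nearW.
  apply: filterS cvM => w cw.
  (* Bounded support gives uniform convergence, so the error is eventually at most 1, which serves
     as [C]. *)
  have near_bound := mhat_unif_cvg hA L0 Noo (supp_bounded mX hA Xr) cw ltr01.
  by apply: square_error_cvg near_bound => //; exact: mhat_cvg.
Qed.
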